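(* (i) Let $\phi$ (with gauge potential $A$) solve the covariant self-dual Chern–Simons–Schrödinger equation. Then $\tilde{\mathbf D}_+\phi$ solves $$\big(i\mathbf D_t+\tfrac12|\phi|^2\big)\tilde{\mathbf D}_+\phi-\tilde{\mathbf D}_+^*\tilde{\mathbf D}_+\tilde{\mathbf D}_+\phi=0.$$ (ii) At the linearized level around the static solution $Q$, one has the conjugation identity $$L_Q\,i\,L_Q^*=i\,A_Q^*A_Q,$$ where $A_Q=\partial_r-\frac{m+1+A_\theta[Q]}{r}$ is the radial part of $\tilde{\mathbf D}_+^{(Q)}$ acting on $(m+1)$-equivariant functions, i.e. $\tilde{\mathbf D}_+^{(Q)}(f(r)e^{i(m+1)\theta})=[A_Qf](r)e^{i(m+2)\theta}$.
   Context: The covariant self-dual Chern–Simons–Schrödinger equation for a (sufficiently regular) scalar field $\phi:\mathbb R^{1+2}\to\mathbb C$ and a real-valued 1-form $A=A_0dt+A_1dx_1+A_2dx_2$ is $$\mathbf D_t\phi=i\mathbf D_j\mathbf D_j\phi+i|\phi|^2\phi,\quad F_{01}=-\mathrm{Im}(\overline\phi\mathbf D_2\phi),\quad F_{02}=\mathrm{Im}(\overline\phi\mathbf D_1\phi),\quad F_{12}=-\tfrac12|\phi|^2,$$ where $\mathbf D_\alpha=\partial_\alpha+iA_\alpha$ ($\alpha=0,1,2$, $\mathbf D_t=\mathbf D_0$), $F_{\alpha\beta}=\partial_\alpha A_\beta-\partial_\beta A_\alpha$, and $j$ is summed over $\{1,2\}$. The Bogomol'nyi operator is $\tilde{\mathbf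 D}_+:=\mathbf D_1+i\mathbf D_2$, with formal $L^2$-adjoint $\tilde{\mathbf D}_+^*=-\mathbf D_1+i\mathbf D_2$. $\tilde{\mathbf D}_+^{(Q)}$ denotes this operator with the Coulomb-gauge potentials generated by the $m$-equivariant field $Q(r)e^{im\theta}$, i.e. $A_r=0$ and angular component $A_\theta[Q]$. Let $m\ge0$ be an integer, $Q(r)=\sqrt8(m+1)\frac{r^m}{1+r^{2(m+1)}}$, $A_\theta[Q](r)=-\frac12\int_0^rQ^2r'dr'$. For complex functions on $(0,\infty)$, $(f,g)_r:=\mathrm{Re}\,2\pi\int_0^\infty\overline fg\,r\,dr$, and $B_Qf(r)=\frac1r\int_0^r\mathrm{Re}(Qf)r'dr'$. The linearized Bogomol'nyi operator is $L_Qf=\partial_rf-\frac{m+A_\theta[Q]}rf+QB_Qf$ (only $\mathbb R$-linear). Adjoints are with respect to $(\cdot,\cdot)_r$: $L_Q^*f=-\partial_rf-\frac{m+1+A_\theta[Q]}rf+Q\int_r^\infty\mathrm{Re}(Qf)dr'$ and $A_Q^*f=-\partial_rf-\frac{m+2+A_\theta[Q]}rf$. The operator identity in (ii) is understood on radial parts of $(m+1)$-equivariant Schwartz functions. *)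

(* Defs.v *)
From Stdlib Require Import Reals.
From Coquelicot Require Import Coquelicot.
Open Scope R_scope.

(* Complex-valued total derivative: Coquelicot's [Derive] is real-valued only. *)
Definition CDerive (f : R -> C) (x : R) : C :=
  (Derive (fun s => Re (f s)) x, Derive (fun s => Im (f s)) x).

Definition Cex_derive (f : R -> C) (x : R) : Prop :=
  ex_derive (fun s => Re (f s)) x /\ ex_derive (fun s => Im (f s)) x.

Definition plane : NormedModule R_AbsRing :=
  prod_NormedModule R_AbsRing R_NormedModule R_NormedModule.

(* Points are written [((t, x1), x2)]. *)
Definition spacetime : NormedModule R_AbsRing :=
  prod_NormedModule R_AbsRing plane R_NormedModule.

Definition e_t : spacetime := ((1, 0), 0).
Definition e_1 : spacetime := ((0, 1), 0).
Definition e_2 : spacetime := ((0, 0), 1).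

Definition ex_1 : plane := (1, 0).
Definition ex_2 : plane := (0, 1).

(* Partial derivatives are directional derivatives along the vectors above. *)
Definition pder {X : NormedModule R_AbsRing} (e : X) (u : X -> R) (p : X) : R :=
  Derive (fun s : R => u (plus p (scal s e))) 0.

Definition Cpder {X : NormedModule R_AbsRing} (e : X) (u : X -> C) (p : X) : C :=
  CDerive (fun s : R => u (plus p (scal s e))) 0.

(* Class C^k.  Asking for continuous derivatives in every direction is the same
   as asking for continuous partial derivatives along a basis. *)
Fixpoint class_C {X : NormedModule R_AbsRing} (k : nat) (u : X -> R) : Prop :=
  (forall p : X, continuous u p) /\
  match k with
  | O => True
  | S k' =>
      forall e : X,
        (forall p : X, ex_derive (fun s : R => u (plus p (scal s e))) 0) /\
        class_C k' (pder e u)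
  end.

Definition Cclass_C {X : NormedModule R_AbsRing} (k : nat) (u : X -> C) : Prop :=
  class_C k (fun p => Re (u p)) /\ class_C k (fun p => Im (u p)).

(* D_e u = d_e u + i a u, where [a] is the component of the potential along [e]. *)
Definition Dcov {X : NormedModule R_AbsRing} (e : X) (a : X -> R)
    (u : X -> C) (p : X) : C :=
  (Cpder e u p + Ci * RtoC (a p) * u p)%C.

Definition curv {X : NormedModule R_AbsRing} (e e' : X) (a a' : X -> R) (p : X) : R :=
  pder e a' p - pder e' a p.

Definition Dplus {X : NormedModule R_AbsRing} (e1 e2 : X) (A1 A2 : X -> R)
    (u : X -> C) (p : X) : C :=
  (Dcov e1 A1 u p + Ci * Dcov e2 A2 u p)%C.

Definition Dplus_adj {X : NormedModule R_AbsRing} (e1 e2 : X) (A1 A2 : X -> R)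
    (u : X -> C) (p : X) : C :=
  (- Dcov e1 A1 u p + Ci * Dcov e2 A2 u p)%C.

Definition CSS_solution (phi : spacetime -> C) (A0 A1 A2 : spacetime -> R) : Prop :=
  forall p : spacetime,
    Dcov e_t A0 phi p =
      (Ci * (Dcov e_1 A1 (Dcov e_1 A1 phi) p + Dcov e_2 A2 (Dcov e_2 A2 phi) p)
       + Ci * RtoC (Cmod (phi p) ^ 2) * phi p)%C /\
    curv e_t e_1 A0 A1 p = - Im (Cconj (phi p) * Dcov e_2 A2 phi p)%C /\
    curv e_t e_2 A0 A2 p = Im (Cconj (phi p) * Dcov e_1 A1 phi p)%C /\
    curv e_1 e_2 A1 A2 p = - (1 / 2) * Cmod (phi p) ^ 2.

Definition Q (m : nat) (r : R) : R :=
  sqrt 8 * (INR m + 1) * (r ^ m / (1 + r ^ (2 * (m + 1)))).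

Definition Atheta (m : nat) (r : R) : R :=
  - (1 / 2) * RInt (fun s => Q m s ^ 2 * s) 0 r.

(* The 1-form A_theta dtheta, with dtheta = (x1 dx2 - x2 dx1) / |x|^2, in Cartesian
   components; these are only used away from the origin. *)
Definition radius (x : plane) : R := sqrt (fst x ^ 2 + snd x ^ 2).

Definition AQ_1 (m : nat) (x : plane) : R :=
  - Atheta m (radius x) * snd x / radius x ^ 2.

Definition AQ_2 (m : nat) (x : plane) : R :=
  Atheta m (radius x) * fst x / radius x ^ 2.

Definition DplusQ (m : nat) (u : plane -> C) (x : plane) : C :=
  Dplus ex_1 ex_2 (AQ_1 m) (AQ_2 m) u x.

(* A function on (0, oo) is a total function on R; all operators below, at r > 0,
   depend only on its values on (0, oo). *)
Definition B_Q (m : nat) (f : R -> C) (r : R) : R :=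
  / r * RInt (fun s => Re (RtoC (Q m s) * f s)%C * s) 0 r.

Definition L_Q (m : nat) (f : R -> C) (r : R) : C :=
  (CDerive f r - RtoC ((INR m + Atheta m r) / r) * f r
   + RtoC (Q m r * B_Q m f r))%C.

Definition L_Q_adj (m : nat) (f : R -> C) (r : R) : C :=
  (- CDerive f r - RtoC ((INR m + 1 + Atheta m r) / r) * f r
   + RtoC (Q m r * RInt_gen (fun s => Re (RtoC (Q m s) * f s)%C)
                     (at_point r) (Rbar_locally p_infty)))%C.

Definition A_Q (m : nat) (f : R -> C) (r : R) : C :=
  (CDerive f r - RtoC ((INR m + 1 + Atheta m r) / r) * f r)%C.

Definition A_Q_adj (m : nat) (f : R -> C) (r : R) : C :=
  (- CDerive f r - RtoC ((INR m + 2 + Atheta m r) / r) * f r)%C.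

Definition cis (t : R) : C := (cos t, sin t).

(* F(r e^{i theta}) = f(r) e^{i k theta}; the value of F at 0 is not constrained. *)
Definition equivariant (k : nat) (f : R -> C) (F : plane -> C) : Prop :=
  forall r theta : R, 0 < r ->
    F (r * cos theta, r * sin theta) = (f r * cis (INR k * theta))%C.

Definition schwartz (F : plane -> C) : Prop :=
  (forall k : nat, Cclass_C k F) /\
  forall N a b : nat, exists M : R, forall x : plane,
    radius x ^ N *
      Cmod (Nat.iter a (Cpder ex_1) (Nat.iter b (Cpder ex_2) F) x) <= M.

(* Main.v *)
Require Import Defs.
From Stdlib Require Import Reals Lra Lia FunctionalExtensionality.
From Coquelicot Require Import Coquelicot.
Open Scope R_scope.

(** The equation of part (i) comes from a factorization of the covariant
    Laplacian.  Write [D = D_1 + i D_2] and [D* = - D_1 + i D_2].  Since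
    [[D_a, D_b] = i F_ab] (lemma [Dcov_comm], where the symmetry of second
    derivatives enters), [D* D = - D_j D_j + F_12], and the constraint
    [F_12 = - |phi|^2 / 2] turns the Schroedinger equation into
    [i D_t phi = D* D phi - |phi|^2 phi / 2] ([CSS_factorized]).  Now apply [D].
    On the left, commuting [D] with [D_t] costs the electric field
    [(F_01 + i F_02) phi]; on the right, [D D* = D* D + |phi|^2], and the Leibniz
    rule differentiates [|phi|^2].  With [a = conj(phi) D_1 phi] and
    [b = conj(phi) D_2 phi] the electric field is [- Im b + i Im a] and
    [(d_1 + i d_2) |phi|^2 / 2 = Re a + i Re b], so the two add up to
    [a + i b = conj(phi) D phi].  Multiplied by [phi] this is [|phi|^2 D phi],
    which cancels the [|phi|^2] in [D D*].

    In part (ii), let [a = m + 1 + A_theta].  Three facts about [Q] do all the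
    work: the Bogomolnyi equation [Q' = (m + A_theta) Q / r] ([is_derive_Q]), the
    constraint [A_theta' = - r Q^2 / 2], and the decay at infinity of [Q f], which
    makes the nonlocal term [T(r) = int_r^oo Re (Q f)] of [L_Q^* f] differentiable
    with [T' = - Re (Q f)].  By the first of them [(d_r - (a - 1) / r)] annihilates
    [Q], hence maps [Q T] to [- Q^2 Re f]; the real part of [i L_Q^* f] is
    [(Im f)' + a Im f / r], and multiplied by [r Q] it is the exact derivative of
    [r Q Im f], so that [B_Q (i L_Q^* f) = Q Im f] ([B_Q_i_L_Q_adj]).  The two
    nonlocal terms thus leave the local one [- i Q^2 f], and what remains is the
    identity of second-order operators
    [(d_r - (a - 1) / r)(d_r + a / r) + Q^2 = (d_r + (a + 1) / r)(d_r - a / r)],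
    whose two sides differ by [Q^2 + 2 a' / r = 0].

    The last claim is the expression of [d_1 + i d_2] in polar coordinates. *)

(** * Calculus of functions of class C^k *)

Section Regularity.
Context {X : NormedModule R_AbsRing}.
Implicit Types (u v : X -> R) (e p : X).

Lemma plus_scal_0 p e : plus p (scal 0 e) = p.
Proof.
  transitivity (plus p zero); [f_equal; apply (scal_zero_l e)|].
  apply plus_zero_r.
Qed.

Lemma class_C_pred k u : class_C (S k) u -> class_C k u.
Proof.
  revert u; induction k as [|k IH]; intros u [Hc Hd]; split; auto.
  intros e; destruct (Hd e) as [Hex Hk]; split; auto.
Qed.

Lemma class_C_continuous k u : class_C k u -> forall p, continuous u p.
Proof. now destruct k; intros [H _]. Qed.

Lemma class_C_ex_pder k u e p :
  class_C (S k) u -> ex_derive (fun s : R => u (plus p (scal s e))) 0.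
Proof. intros [_ H]; apply H. Qed.

Lemma class_C_pder k u e : class_C (S k) u -> class_C k (pder e u).
Proof. intros [_ H]; apply H. Qed.

Lemma pder_const e (c : R) : pder e (fun _ : X => c) = fun _ => 0.
Proof. extensionality p; exact (Derive_const c 0). Qed.

Lemma pder_plus k u v e : class_C (S k) u -> class_C (S k) v ->
  pder e (fun p => u p + v p) = fun p => pder e u p + pder e v p.
Proof.
  intros Hu Hv; extensionality p; unfold pder.
  apply Derive_plus; eapply class_C_ex_pder; eassumption.
Qed.

Lemma pder_opp u e : pder e (fun p => - u p) = fun p => - pder e u p.
Proof. extensionality p; unfold pder; apply Derive_opp. Qed.

Lemma pder_mult k u v e : class_C (S k) u -> class_C (S k) v ->
  pder e (fun p => u p * v p) = fun p => pder e u p * v p + u p * pder e v p.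
Proof.
  intros Hu Hv; extensionality p; unfold pder.
  rewrite Derive_mult by (eapply class_C_ex_pder; eassumption).
  now rewrite !plus_scal_0.
Qed.

Lemma class_C_const k (c : R) : class_C k (fun _ : X => c).
Proof.
  revert c; induction k as [|k IH]; intros c; split; auto.
  1, 2: intros p; apply continuous_const.
  intros e; split; [intros p; apply ex_derive_const|].
  rewrite pder_const; apply IH.
Qed.

Lemma class_C_plus k u v :
  class_C k u -> class_C k v -> class_C k (fun p => u p + v p).
Proof.
  revert u v; induction k as [|k IH]; intros u v Hu Hv; split; auto.
  1, 2: intros p; apply (continuous_plus u v);
    eapply class_C_continuous; eassumption.
  intros e; split.
  - intros p; apply (ex_derive_plus (K := R_AbsRing) (V := R_NormedModule));
      eapply class_C_ex_pder; eassumption.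
  - rewrite (pder_plus k) by assumption.
    apply IH; apply class_C_pder; assumption.
Qed.

Lemma class_C_opp k u : class_C k u -> class_C k (fun p => - u p).
Proof.
  revert u; induction k as [|k IH]; intros u Hu; split; auto.
  1, 2: intros p; apply (continuous_opp u);
    eapply class_C_continuous; eassumption.
  intros e; split.
  - intros p; apply (ex_derive_opp (K := R_AbsRing) (V := R_NormedModule));
      eapply class_C_ex_pder; eassumption.
  - rewrite pder_opp; apply IH; apply class_C_pder; assumption.
Qed.

Lemma class_C_mult k u v :
  class_C k u -> class_C k v -> class_C k (fun p => u p * v p).
Proof.
  revert u v; induction k as [|k IH]; intros u v Hu Hv; split; auto.
  1, 2: intros p; apply (continuous_mult u v);
    eapply class_C_continuous; eassumption.
  intros e; split.
  - intros p; apply ex_derive_mult; eapply class_C_ex_pder; eassumption.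
  - rewrite (pder_mult k) by assumption.
    apply class_C_plus; apply IH;
      solve [apply class_C_pder; assumption | apply class_C_pred; assumption].
Qed.

(** Differentiability at [0] of every translate is all that [class_C] provides;
    restricted to a line, it gives differentiability at every parameter. *)
Lemma is_derive_line k u e p (s0 : R) : class_C (S k) u ->
  is_derive (fun s : R => u (plus p (scal s e))) s0
    (pder e u (plus p (scal s0 e))).
Proof.
  intros Hu.
  pose (w := fun t : R => u (plus (plus p (scal s0 e)) (scal t e))).
  apply is_derive_ext with (fun s => w (s - s0)).
  { intros s; unfold w; f_equal.
    rewrite <- plus_assoc; f_equal.
    etransitivity; [symmetry; apply (scal_distr_r s0 (s - s0) e)|].
    f_equal; unfold plus; simpl; ring. }
  replace (pder e u (plus p (scal s0 e))) with (scal 1 (Derive w 0))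
    by apply Rmult_1_l.
  apply (is_derive_comp w (fun s => s - s0)).
  - replace (s0 - s0) with 0 by ring.
    apply Derive_correct; unfold w; eapply class_C_ex_pder; eassumption.
  - auto_derive; auto; ring.
Qed.

(** Schwarz's theorem for the two-variable function [u (p + a e + b e')]. *)
Lemma pder_comm u e e' p : class_C 2 u ->
  pder e (pder e' u) p = pder e' (pder e u) p.
Proof.
  intros Hu.
  pose (f := fun a b : R => u (plus (plus p (scal a e)) (scal b e'))).
  assert (swap : forall a b, f a b = u (plus (plus p (scal b e')) (scal a e))).
  { intros a b; unfold f; f_equal.
    rewrite <- !plus_assoc; f_equal; apply plus_comm. }
  assert (D2 : forall z v : R, Derive (fun t => f z t) v
     = pder e' u (plus (plus p (scal z e)) (scal v e'))).
  { intros z v; apply is_derive_unique, (is_derive_line 1); assumption. }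
  assert (D1 : forall z v : R, Derive (fun t => f t z) v
     = pder e u (plus (plus p (scal z e')) (scal v e))).
  { intros z v; rewrite (Derive_ext _ _ _ (fun t => swap t z)).
    apply is_derive_unique, (is_derive_line 1); assumption. }
  assert (S2 : forall z v : R, plus (plus p (scal z e)) (scal v e')
             = plus (plus p (scal v e')) (scal z e)).
  { intros z v; rewrite <- !plus_assoc; f_equal; apply plus_comm. }
  assert (D12 : forall x y : R, is_derive (fun z => Derive (fun t => f z t) y) x
     (pder e (pder e' u) (plus (plus p (scal y e')) (scal x e)))).
  { intros x y.
    apply is_derive_ext with
      (fun z => pder e' u (plus (plus p (scal y e')) (scal z e))).
    - intros z; rewrite D2, S2; reflexivity.
    - apply (is_derive_line 0), class_C_pder; assumption. }
  assert (D21 : forall x y : R, is_derive (fun z => Derive (fun t => f t z) x) y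
     (pder e' (pder e u) (plus (plus p (scal x e)) (scal y e')))).
  { intros x y.
    apply is_derive_ext with
      (fun z => pder e u (plus (plus p (scal x e)) (scal z e'))).
    - intros z; rewrite D1, S2; reflexivity.
    - apply (is_derive_line 0), class_C_pder; assumption. }
  assert (Hcont : forall (g : X -> R) (a b : X), (forall q, continuous g q) ->
     continuity_2d_pt (fun x y => g (plus (plus p (scal x a)) (scal y b))) 0 0).
  { intros g a b Hg; apply continuity_2d_pt_filterlim.
    apply (continuous_comp
      (fun z : R * R => plus (plus p (scal (fst z) a)) (scal (snd z) b)) g);
      [|apply Hg].
    apply (continuous_plus (V := X)); [apply (continuous_plus (V := X))|].
    - apply continuous_const.
    - apply (continuous_scal_l (V := X)), continuous_fst.
    - apply (continuous_scal_l (V := X)), continuous_snd. }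
  enough (E : pder e (pder e' u) (plus (plus p (scal 0 e')) (scal 0 e))
            = pder e' (pder e u) (plus (plus p (scal 0 e)) (scal 0 e')))
    by (rewrite !plus_scal_0 in E; exact E).
  rewrite <- (is_derive_unique _ _ _ (D12 0 0)),
    <- (is_derive_unique _ _ _ (D21 0 0)).
  apply (Schwarz f).
  - exists (mkposreal 1 Rlt_0_1); intros x y _ _; repeat split.
    + apply ex_derive_ext with (fun z => u (plus (plus p (scal y e')) (scal z e))).
      { intros t; symmetry; apply swap. }
      eexists; apply (is_derive_line 1); assumption.
    + eexists; apply (is_derive_line 1); assumption.
    + eexists; apply D12.
    + eexists; apply D21.
  - apply continuity_2d_pt_ext with
      (fun x y => pder e (pder e' u) (plus (plus p (scal x e)) (scal y e'))).
    { intros x y; rewrite S2; symmetry; apply is_derive_unique, D12. }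
    apply Hcont, (class_C_continuous 0); do 2 apply class_C_pder; assumption.
  - apply continuity_2d_pt_ext with
      (fun x y => pder e' (pder e u) (plus (plus p (scal x e)) (scal y e'))).
    { intros x y; symmetry; apply is_derive_unique, D21. }
    apply Hcont, (class_C_continuous 0); do 2 apply class_C_pder; assumption.
Qed.
End Regularity.

(** * Covariant derivatives *)

Section Covariant.
Context {X : NormedModule R_AbsRing}.
Implicit Types (u v g : X -> C) (a : X -> R) (e p : X).

Lemma Cclass_C_le j k u : (j <= k)%nat -> Cclass_C k u -> Cclass_C j u.
Proof.
  induction 1 as [|k _ IH]; [auto|].
  intros [Hr Hi]; apply IH; split; apply class_C_pred; assumption.
Qed.

Lemma Cclass_C_RtoC k a : class_C k a -> Cclass_C k (fun p => RtoC (a p)).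
Proof. intros Ha; split; [exact Ha|exact (class_C_const k 0)]. Qed.

Lemma Cclass_C_const k (c : C) : Cclass_C k (fun _ : X => c).
Proof. exact (conj (class_C_const k (Re c)) (class_C_const k (Im c))). Qed.

Lemma Cclass_C_plus k u v :
  Cclass_C k u -> Cclass_C k v -> Cclass_C k (fun p => u p + v p)%C.
Proof. intros [] []; split; apply class_C_plus; assumption. Qed.

Lemma Cclass_C_opp k u : Cclass_C k u -> Cclass_C k (fun p => - u p)%C.
Proof. intros []; split; apply class_C_opp; assumption. Qed.

Lemma Cclass_C_mult k u v :
  Cclass_C k u -> Cclass_C k v -> Cclass_C k (fun p => u p * v p)%C.
Proof.
  intros [Hu1 Hu2] [Hv1 Hv2]; split.
  - exact (class_C_plus k _ _ (class_C_mult k _ _ Hu1 Hv1)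
             (class_C_opp k _ (class_C_mult k _ _ Hu2 Hv2))).
  - exact (class_C_plus k _ _ (class_C_mult k _ _ Hu1 Hv2)
             (class_C_mult k _ _ Hu2 Hv1)).
Qed.

Lemma Cclass_C_Cpder k u e : Cclass_C (S k) u -> Cclass_C k (Cpder e u).
Proof.
  intros [Hr Hi].
  exact (conj (class_C_pder k _ e Hr) (class_C_pder k _ e Hi)).
Qed.

Lemma Cclass_C_Dcov k e a u :
  Cclass_C (S k) u -> class_C k a -> Cclass_C k (Dcov e a u).
Proof.
  intros Hu Ha; apply Cclass_C_plus; [apply Cclass_C_Cpder; exact Hu|].
  apply Cclass_C_mult; [|apply Cclass_C_le with (S k); [lia|exact Hu]].
  apply Cclass_C_mult; [apply Cclass_C_const|apply Cclass_C_RtoC, Ha].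
Qed.

Lemma Cpder_const e (c : C) : Cpder e (fun _ : X => c) = fun _ => 0%C.
Proof.
  extensionality p.
  exact (f_equal2 pair (f_equal (fun h => h p) (pder_const e (Re c)))
                       (f_equal (fun h => h p) (pder_const e (Im c)))).
Qed.

Lemma Cpder_RtoC e a p : Cpder e (fun p => RtoC (a p)) p = RtoC (pder e a p).
Proof.
  exact (f_equal2 pair eq_refl (f_equal (fun h => h p) (pder_const e 0))).
Qed.

Lemma Cpder_plus e u v p : Cclass_C 1 u -> Cclass_C 1 v ->
  Cpder e (fun p => u p + v p)%C p = (Cpder e u p + Cpder e v p)%C.
Proof.
  intros [Hu1 Hu2] [Hv1 Hv2].
  exact (f_equal2 pair (f_equal (fun h => h p) (pder_plus 0 _ _ e Hu1 Hv1))
                       (f_equal (fun h => h p) (pder_plus 0 _ _ e Hu2 Hv2))).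
Qed.

Lemma Cpder_mult e u v p : Cclass_C 1 u -> Cclass_C 1 v ->
  Cpder e (fun p => u p * v p)%C p = (Cpder e u p * v p + u p * Cpder e v p)%C.
Proof.
  intros [Hu1 Hu2] [Hv1 Hv2].
  change (Cpder e (fun p => u p * v p)%C p) with
    (pder e (fun p => Re (u p) * Re (v p) + - (Im (u p) * Im (v p))) p,
     pder e (fun p => Re (u p) * Im (v p) + Im (u p) * Re (v p)) p).
  rewrite (pder_plus 0), (pder_plus 0), pder_opp, !(pder_mult 0) by
    repeat first [assumption | apply class_C_mult | apply class_C_opp].
  unfold Cpder, CDerive, pder; apply injective_projections; simpl;
    unfold Re, Im; ring.
Qed.

Lemma Cpder_comm u e e' p : Cclass_C 2 u ->
  Cpder e (Cpder e' u) p = Cpder e' (Cpder e u) p.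
Proof.
  intros [Hr Hi].
  exact (f_equal2 pair (pder_comm _ e e' p Hr) (pder_comm _ e e' p Hi)).
Qed.

Lemma Dcov_plus e a u v p : Cclass_C 1 u -> Cclass_C 1 v ->
  Dcov e a (fun p => u p + v p)%C p = (Dcov e a u p + Dcov e a v p)%C.
Proof. intros Hu Hv; unfold Dcov; rewrite Cpder_plus by assumption; ring. Qed.

Lemma Dcov_mult e a g u p : Cclass_C 1 g -> Cclass_C 1 u ->
  Dcov e a (fun p => g p * u p)%C p = (Cpder e g p * u p + g p * Dcov e a u p)%C.
Proof. intros Hg Hu; unfold Dcov; rewrite Cpder_mult by assumption; ring. Qed.

Lemma Dcov_scal e a (c : C) u p : Cclass_C 1 u ->
  Dcov e a (fun p => c * u p)%C p = (c * Dcov e a u p)%C.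
Proof.
  intros Hu; rewrite Dcov_mult by (apply Cclass_C_const || exact Hu).
  rewrite Cpder_const; ring.
Qed.

Lemma Ci_sqr : (Ci * Ci)%C = RtoC (- 1).
Proof. apply injective_projections; simpl; ring. Qed.

(** The curvature is the commutator of covariant derivatives: in the expansion [H]
    everything but the derivative of the potential is symmetric in the two
    directions. *)
Lemma Dcov_comm e e' a a' u p : Cclass_C 2 u -> class_C 1 a -> class_C 1 a' ->
  Dcov e a (Dcov e' a' u) p
  = (Dcov e' a' (Dcov e a u) p + Ci * RtoC (curv e e' a a' p) * u p)%C.
Proof.
  intros Hu Ha Ha'.
  assert (H : forall d d' b b', class_C 1 b' -> Dcov d b (Dcov d' b' u) p =
     (Cpder d (Cpder d' u) p + Ci * (RtoC (pder d b' p) * u p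
       + RtoC (b' p) * Cpder d u p + RtoC (b p) * Cpder d' u p)
      + Ci * Ci * RtoC (b p) * RtoC (b' p) * u p)%C).
  { intros d d' b b' Hb'.
    assert (Hu1 : Cclass_C 1 u) by (apply Cclass_C_le with 2%nat; [lia|exact Hu]).
    assert (Hg : Cclass_C 1 (fun p => Ci * RtoC (b' p))%C).
    { apply Cclass_C_mult; [apply Cclass_C_const|apply Cclass_C_RtoC, Hb']. }
    unfold Dcov at 1; unfold Dcov at 1.
    rewrite Cpder_plus, Cpder_mult, Cpder_mult, Cpder_const, Cpder_RtoC by
      first [ assumption | apply Cclass_C_const | apply Cclass_C_RtoC, Hb'
            | apply Cclass_C_Cpder, Hu
            | apply Cclass_C_mult; assumption ].
    unfold Dcov; ring. }
  rewrite (H e e' a a' Ha'), (H e' e a' a Ha), (Cpder_comm u e e' p Hu).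
  unfold curv; rewrite RtoC_minus; ring.
Qed.

Lemma Cmod_sqr (z : C) : Cmod z ^ 2 = Re z * Re z + Im z * Im z.
Proof.
  unfold Cmod; rewrite pow2_sqrt.
  - unfold Re, Im; ring.
  - apply Rplus_le_le_0_compat; apply pow2_ge_0.
Qed.

Lemma class_C_Cmod_sqr k u : Cclass_C k u -> class_C k (fun p => Cmod (u p) ^ 2).
Proof.
  intros [Hr Hi].
  replace (fun p => Cmod (u p) ^ 2)
    with (fun p => Re (u p) * Re (u p) + Im (u p) * Im (u p)).
  - apply class_C_plus; apply class_C_mult; assumption.
  - extensionality q; symmetry; apply Cmod_sqr.
Qed.

(** The connection is metric because [a] is real: the term [i a u] is orthogonal
    to [u]. *)
Lemma pder_Cmod_sqr e a u p : Cclass_C 1 u ->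
  pder e (fun p => Cmod (u p) ^ 2) p = 2 * Re (Cconj (u p) * Dcov e a u p)%C.
Proof.
  intros [Hr Hi].
  replace (fun p => Cmod (u p) ^ 2)
    with (fun p => Re (u p) * Re (u p) + Im (u p) * Im (u p))
    by (extensionality q; symmetry; apply Cmod_sqr).
  rewrite (pder_plus 0), !(pder_mult 0) by
    repeat first [assumption | apply class_C_mult].
  unfold Dcov, Cpder, CDerive, pder; simpl; unfold Re, Im; ring.
Qed.

Section Bogomolnyi.
Variables (e1 e2 : X) (A1 A2 : X -> R).
Local Notation Dp := (Dplus e1 e2 A1 A2).
Local Notation Da := (Dplus_adj e1 e2 A1 A2).

Lemma Cclass_C_Dplus k u : Cclass_C (S k) u -> class_C k A1 -> class_C k A2 ->
  Cclass_C k (Dp u).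
Proof.
  intros Hu H1 H2; apply Cclass_C_plus; [apply Cclass_C_Dcov; assumption|].
  apply Cclass_C_mult; [apply Cclass_C_const|apply Cclass_C_Dcov; assumption].
Qed.

Lemma Cclass_C_Dplus_adj k u :
  Cclass_C (S k) u -> class_C k A1 -> class_C k A2 -> Cclass_C k (Da u).
Proof.
  intros Hu H1 H2; apply Cclass_C_plus;
    [apply Cclass_C_opp, Cclass_C_Dcov; assumption|].
  apply Cclass_C_mult; [apply Cclass_C_const|apply Cclass_C_Dcov; assumption].
Qed.

Lemma Dplus_plus u v p : Cclass_C 1 u -> Cclass_C 1 v ->
  Dp (fun p => u p + v p)%C p = (Dp u p + Dp v p)%C.
Proof. intros Hu Hv; unfold Dplus; rewrite !Dcov_plus by assumption; ring. Qed.

Lemma Dplus_scal (c : C) u p : Cclass_C 1 u ->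
  Dp (fun p => c * u p)%C p = (c * Dp u p)%C.
Proof. intros Hu; unfold Dplus; rewrite !Dcov_scal by assumption; ring. Qed.

Lemma Dplus_mult g u p : Cclass_C 1 g -> Cclass_C 1 u ->
  Dp (fun p => g p * u p)%C p
  = ((Cpder e1 g p + Ci * Cpder e2 g p) * u p + g p * Dp u p)%C.
Proof. intros Hg Hu; unfold Dplus; rewrite !Dcov_mult by assumption; ring. Qed.

Hypotheses (HA1 : class_C 1 A1) (HA2 : class_C 1 A2).

(** The Weitzenboeck formula: the cross terms of the product form the commutator
    [- i [D_1, D_2]]. *)
Lemma Dplus_adj_Dplus u p : Cclass_C 2 u ->
  Da (Dp u) p
  = (- (Dcov e1 A1 (Dcov e1 A1 u) p + Dcov e2 A2 (Dcov e2 A2 u) p)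
     + RtoC (curv e1 e2 A1 A2 p) * u p)%C.
Proof.
  intros Hu; unfold Dplus_adj, Dplus.
  assert (H1 := Cclass_C_Dcov 1 e1 A1 u Hu HA1).
  assert (H2 := Cclass_C_Dcov 1 e2 A2 u Hu HA2).
  assert (H3 : Cclass_C 1 (fun p => Ci * Dcov e2 A2 u p)%C).
  { apply Cclass_C_mult; [apply Cclass_C_const|exact H2]. }
  rewrite !Dcov_plus, !Dcov_scal by assumption.
  rewrite (Dcov_comm e1 e2 A1 A2 u p Hu HA1 HA2).
  ring [Ci_sqr].
Qed.

(** In the other order the cross terms, hence the curvature, change sign. *)
Lemma Dplus_Dplus_adj u p : Cclass_C 2 u ->
  Dp (Da u) p = (Da (Dp u) p - 2 * RtoC (curv e1 e2 A1 A2 p) * u p)%C.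
Proof.
  intros Hu; rewrite Dplus_adj_Dplus by exact Hu; unfold Dplus_adj, Dplus.
  assert (H1 := Cclass_C_Dcov 1 e1 A1 u Hu HA1).
  assert (H2 := Cclass_C_Dcov 1 e2 A2 u Hu HA2).
  assert (H3 : Cclass_C 1 (fun p => Ci * Dcov e2 A2 u p)%C).
  { apply Cclass_C_mult; [apply Cclass_C_const|exact H2]. }
  assert (H4 : Cclass_C 1 (fun p => - Dcov e1 A1 u p)%C) by
    (apply Cclass_C_opp; exact H1).
  replace (fun p => - Dcov e1 A1 u p + Ci * Dcov e2 A2 u p)%C with
    (fun p => RtoC (-1) * Dcov e1 A1 u p + Ci * Dcov e2 A2 u p)%C.
  2:{ extensionality q; ring. }
  rewrite !Dcov_plus, !Dcov_scal by
    first [assumption | apply Cclass_C_mult; [apply Cclass_C_const|assumption]].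
  rewrite (Dcov_comm e1 e2 A1 A2 u p Hu HA1 HA2).
  ring [Ci_sqr].
Qed.

Lemma Dplus_Dcov_comm e0 A0 u p : Cclass_C 2 u -> class_C 1 A0 ->
  Dp (Dcov e0 A0 u) p
  = (Dcov e0 A0 (Dp u) p
     + (RtoC (curv e0 e2 A0 A2 p) - Ci * RtoC (curv e0 e1 A0 A1 p)) * u p)%C.
Proof.
  intros Hu HA0; unfold Dplus.
  assert (H1 := Cclass_C_Dcov 1 e1 A1 u Hu HA1).
  assert (H2 := Cclass_C_Dcov 1 e2 A2 u Hu HA2).
  assert (H3 : Cclass_C 1 (fun p => Ci * Dcov e2 A2 u p)%C).
  { apply Cclass_C_mult; [apply Cclass_C_const|exact H2]. }
  rewrite Dcov_plus, Dcov_scal by assumption.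
  rewrite (Dcov_comm e0 e1 A0 A1 u p Hu HA0 HA1).
  rewrite (Dcov_comm e0 e2 A0 A2 u p Hu HA0 HA2).
  ring [Ci_sqr].
Qed.
End Bogomolnyi.
End Covariant.

(** * The equation satisfied by the Bogomolnyi derivative *)

(** The sign in [F_12 = - |phi|^2 / 2] is the self-dual one: the curvature absorbs
    half of the nonlinearity. *)
Lemma CSS_factorized (phi : spacetime -> C) (A0 A1 A2 : spacetime -> R) p :
  Cclass_C 2 phi -> class_C 1 A1 -> class_C 1 A2 ->
  CSS_solution phi A0 A1 A2 ->
  (Ci * Dcov e_t A0 phi p)%C
  = (Dplus_adj e_1 e_2 A1 A2 (Dplus e_1 e_2 A1 A2 phi) p
     + RtoC (- (1 / 2)) * (RtoC (Cmod (phi p) ^ 2) * phi p))%C.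
Proof.
  intros Hphi HA1 HA2 Hsol; destruct (Hsol p) as (Ht & _ & _ & H12).
  rewrite Dplus_adj_Dplus by assumption.
  rewrite Ht, H12.
  generalize (Dcov e_1 A1 (Dcov e_1 A1 phi) p) (Dcov e_2 A2 (Dcov e_2 A2 phi) p)
    (Cmod (phi p) ^ 2) (phi p).
  intros [x1 x2] [y1 y2] N [f1 f2].
  apply injective_projections; simpl; field.
Qed.

Lemma CSS_Dplus (phi : spacetime -> C) (A0 A1 A2 : spacetime -> R) p :
  Cclass_C 3 phi -> class_C 2 A0 -> class_C 2 A1 -> class_C 2 A2 ->
  CSS_solution phi A0 A1 A2 ->
  (Ci * Dcov e_t A0 (Dplus e_1 e_2 A1 A2 phi) p
   + RtoC (1 / 2 * Cmod (phi p) ^ 2) * Dplus e_1 e_2 A1 A2 phi p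
   - Dplus_adj e_1 e_2 A1 A2
       (Dplus e_1 e_2 A1 A2 (Dplus e_1 e_2 A1 A2 phi)) p)%C = RtoC 0.
Proof.
  intros Hphi HA0 HA1 HA2 Hsol.
  assert (B0 := class_C_pred 1 _ HA0).
  assert (B1 := class_C_pred 1 _ HA1).
  assert (B2 := class_C_pred 1 _ HA2).
  assert (Hphi2 : Cclass_C 2 phi) by
    (apply Cclass_C_le with 3%nat; [lia|exact Hphi]).
  assert (Hphi1 : Cclass_C 1 phi) by
    (apply Cclass_C_le with 3%nat; [lia|exact Hphi]).
  assert (Hpsi := Cclass_C_Dplus e_1 e_2 A1 A2 2 phi Hphi HA1 HA2).
  assert (Hg : Cclass_C 1 (fun p => RtoC (Cmod (phi p) ^ 2))).
  { apply Cclass_C_RtoC, class_C_Cmod_sqr, Hphi1. }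
  (* The Bogomolnyi operator applied to both sides of the factorized equation. *)
  assert (HD : (Ci * Dplus e_1 e_2 A1 A2 (Dcov e_t A0 phi) p)%C
     = (Dplus e_1 e_2 A1 A2 (Dplus_adj e_1 e_2 A1 A2 (Dplus e_1 e_2 A1 A2 phi)) p
        + RtoC (- (1 / 2)) * ((Cpder e_1 (fun p => RtoC (Cmod (phi p) ^ 2)) p
            + Ci * Cpder e_2 (fun p => RtoC (Cmod (phi p) ^ 2)) p) * phi p
            + RtoC (Cmod (phi p) ^ 2) * Dplus e_1 e_2 A1 A2 phi p))%C).
  { assert (Hga := Cclass_C_mult 1 _ _ Hg Hphi1).
    rewrite <- (Dplus_mult e_1 e_2 A1 A2 _ _ _ Hg Hphi1).
    rewrite <- (Dplus_scal e_1 e_2 A1 A2 _ _ _ Hga).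
    rewrite <- Dplus_scal by (apply Cclass_C_Dcov; assumption).
    rewrite <- Dplus_plus.
    - f_equal; extensionality q; apply CSS_factorized; assumption.
    - apply Cclass_C_Dplus_adj; assumption.
    - apply Cclass_C_mult; [apply Cclass_C_const|exact Hga]. }
  rewrite Dplus_Dcov_comm, Dplus_Dplus_adj in HD by assumption.
  rewrite !Cpder_RtoC, (pder_Cmod_sqr e_1 A1), (pder_Cmod_sqr e_2 A2) in HD
    by assumption.
  destruct (Hsol p) as (_ & H01 & H02 & H12).
  rewrite H01, H02, H12 in HD.
  set (psi := Dplus e_1 e_2 A1 A2 phi) in *.
  assert (Epsi : psi p = (Dcov e_1 A1 phi p + Ci * Dcov e_2 A2 phi p)%C)
    by reflexivity.
  rewrite Epsi in *.
  rewrite Cmod_sqr in *.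
  (* What is left is an algebraic consequence of [HD] in the values at [p], linear
     in [D_t psi] and [D* D psi]. *)
  generalize dependent (Dcov e_t A0 psi p).
  generalize (Dplus_adj e_1 e_2 A1 A2 (Dplus e_1 e_2 A1 A2 psi) p).
  clear.
  generalize (Dcov e_1 A1 phi p) (Dcov e_2 A2 phi p) (phi p).
  intros [a1 a2] [b1 b2] [f1 f2] [w1 w2] [z1 z2] H.
  injection H; simpl; intros Hi Hr.
  apply injective_projections; simpl; lra.
Qed.

(** * Equivariant functions in polar coordinates *)

Lemma locally_pos (r : R) : 0 < r -> locally r (fun s => 0 < s).
Proof. intros Hr; apply (open_gt 0); exact Hr. Qed.

(** Near a point at distance [r] from the origin, polar coordinates are taken in
    the frame of that point: after a displacement with radial component [s a] and
    angular component [s b], the modulus is [sqrt ((r + s a)^2 + (s b)^2)] and the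
    angle has grown by [atan (s b / (r + s a))].  No global choice of angle is
    involved. *)
Lemma is_derive_local_radius (r a b : R) : 0 < r ->
  is_derive (fun s => sqrt ((r + s * a) ^ 2 + (s * b) ^ 2)) 0 a.
Proof.
  intros Hr.
  assert (E : (r + 0 * a) ^ 2 + (0 * b) ^ 2 = r ^ 2) by ring.
  auto_derive; rewrite ?Rmult_1_r.
  - nra.
  - replace ((r + 0 * a) * (r + 0 * a) + 0 * b * (0 * b)) with (r ^ 2) by ring.
    rewrite sqrt_pow2 by lra; field; lra.
Qed.

Lemma is_derive_local_angle (r a b : R) : 0 < r ->
  is_derive (fun s => atan (s * b / (r + s * a))) 0 (b / r).
Proof.
  intros Hr; auto_derive; unfold Rsqr; [lra|].
  field; lra.
Qed.

Lemma polar_atan (a b : R) : 0 < a ->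
  sqrt (a ^ 2 + b ^ 2) * cos (atan (b / a)) = a /\
  sqrt (a ^ 2 + b ^ 2) * sin (atan (b / a)) = b.
Proof.
  intros Ha.
  assert (E : sqrt (a ^ 2 + b ^ 2) = a * sqrt (1 + (b / a)²)).
  { rewrite <- (sqrt_pow2 a) at 2 by lra.
    rewrite <- sqrt_mult by
      (try apply pow2_ge_0; generalize (Rle_0_sqr (b / a)); lra).
    f_equal; unfold Rsqr; field; lra. }
  assert (0 < sqrt (1 + (b / a)²)).
  { apply sqrt_lt_R0; generalize (Rle_0_sqr (b / a)); lra. }
  rewrite E, cos_atan, sin_atan; split; field; lra.
Qed.

Lemma is_derive_polar (g1 g2 rho delta : R -> R) (k theta r a b d1 d2 : R) :
  rho 0 = r -> delta 0 = 0 -> is_derive rho 0 a -> is_derive delta 0 b ->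
  is_derive g1 r d1 -> is_derive g2 r d2 ->
  is_derive (fun s => g1 (rho s) * cos (k * (theta + delta s))
                      - g2 (rho s) * sin (k * (theta + delta s))) 0
    (a * (d1 * cos (k * theta) - d2 * sin (k * theta))
     - k * b * (g1 r * sin (k * theta) + g2 r * cos (k * theta))) /\
  is_derive (fun s => g1 (rho s) * sin (k * (theta + delta s))
                      + g2 (rho s) * cos (k * (theta + delta s))) 0
    (a * (d1 * sin (k * theta) + d2 * cos (k * theta))
     + k * b * (g1 r * cos (k * theta) - g2 r * sin (k * theta))).
Proof.
  intros <- Hdelta0 Hrho Hdelta H1 H2.
  split; auto_derive.
  1, 3: repeat split; auto; eexists; eassumption.
  all: rewrite (is_derive_unique (fun s : R => rho s) _ _ Hrho),
      (is_derive_unique (fun s : R => delta s) _ _ Hdelta),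
      (is_derive_unique (fun s : R => g1 s) _ _ H1),
      (is_derive_unique (fun s : R => g2 s) _ _ H2), Hdelta0, Rplus_0_r; ring.
Qed.

(** [d_e] is [(e . e_r) d_r + (e . e_theta) / r d_theta], and [d_theta] multiplies a
    [k]-equivariant function by [i k]. *)
Lemma Cpder_equivariant k f F (c1 c2 r theta : R) :
  equivariant k f F -> 0 < r -> Cex_derive f r ->
  Cpder ((c1, c2) : plane) F (r * cos theta, r * sin theta)
  = ((RtoC (c1 * cos theta + c2 * sin theta) * CDerive f r
      + Ci * RtoC (INR k * (c2 * cos theta - c1 * sin theta) / r) * f r)
     * cis (INR k * theta))%C.
Proof.
  intros HF Hr [Hf1 Hf2].
  set (a := c1 * cos theta + c2 * sin theta).
  set (b := c2 * cos theta - c1 * sin theta).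
  pose (rho := fun s => sqrt ((r + s * a) ^ 2 + (s * b) ^ 2)).
  pose (delta := fun s => atan (s * b / (r + s * a))).
  assert (Hrho : is_derive rho 0 a) by (apply is_derive_local_radius; lra).
  assert (Hdelta : is_derive delta 0 (b / r))
    by (apply is_derive_local_angle; lra).
  assert (Hrho0 : rho 0 = r).
  { unfold rho; replace ((r + 0 * a) ^ 2 + (0 * b) ^ 2) with (r ^ 2) by ring.
    apply sqrt_pow2; lra. }
  assert (Hdelta0 : delta 0 = 0).
  { unfold delta; replace (0 * b / (r + 0 * a)) with 0 by (field; lra).
    apply atan_0. }
  assert (Hloc : locally 0 (fun s : R =>
     (f (rho s) * cis (INR k * (theta + delta s)))%C =
     F (plus ((r * cos theta, r * sin theta) : plane)
         (scal s ((c1, c2) : plane))))).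
  { assert (Hc : continuous (fun s => r + s * a) 0).
    { apply (ex_derive_continuous (K := R_AbsRing) (V := R_NormedModule)).
      auto_derive; auto. }
    assert (Hp : locally (r + 0 * a) (fun s => 0 < s)) by (apply locally_pos; lra).
    assert (Hp' : locally 0 (fun s : R => 0 < r + s * a)) by exact (Hc _ Hp).
    revert Hp'; apply filter_imp; intros s Hs.
    assert (Hrp : 0 < rho s).
    { unfold rho; apply sqrt_lt_R0; nra. }
    destruct (polar_atan (r + s * a) (s * b) Hs) as [Ec Es].
    fold (rho s) in Ec, Es; fold (delta s) in Ec, Es.
    rewrite <- (HF _ _ Hrp); f_equal.
    rewrite cos_plus, sin_plus.
    assert (Hcs := sin2_cos2 theta); unfold Rsqr in Hcs.
    apply injective_projections; unfold plus, scal; simpl; unfold plus, scal; simpl;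
      unfold mult; simpl.
    - transitivity (cos theta * (rho s * cos (delta s))
        - sin theta * (rho s * sin (delta s))); [ring|rewrite Ec, Es].
      unfold a, b.
      transitivity (r * cos theta
        + s * c1 * (sin theta * sin theta + cos theta * cos theta));
        [ring|rewrite Hcs; ring].
    - transitivity (sin theta * (rho s * cos (delta s))
        + cos theta * (rho s * sin (delta s))); [ring|rewrite Ec, Es].
      unfold a, b.
      transitivity (r * sin theta
        + s * c2 * (sin theta * sin theta + cos theta * cos theta));
        [ring|rewrite Hcs; ring]. }
  destruct (is_derive_polar (fun s => Re (f s)) (fun s => Im (f s)) rho delta
    (INR k) theta r _ _ _ _ Hrho0 Hdelta0 Hrho Hdelta
    (Derive_correct _ _ Hf1) (Derive_correct _ _ Hf2)) as [D1 D2].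
  unfold Cpder, CDerive at 1; apply injective_projections; simpl fst; simpl snd;
    apply is_derive_unique.
  - refine (is_derive_ext_loc _ _ _ _ _ (eq_rect _ _ D1 _ _)).
    + revert Hloc; apply filter_imp; intros s <-; reflexivity.
    + unfold CDerive; simpl; unfold Re, Im; field; lra.
  - refine (is_derive_ext_loc _ _ _ _ _ (eq_rect _ _ D2 _ _)).
    + revert Hloc; apply filter_imp; intros s <-; reflexivity.
    + unfold CDerive; simpl; unfold Re, Im; field; lra.
Qed.

Lemma DplusQ_equivariant (m : nat) (f : R -> C) (F : plane -> C) (r theta : R) :
  Cex_derive f r -> equivariant (m + 1) f F -> 0 < r ->
  DplusQ m F (r * cos theta, r * sin theta)
  = (A_Q m f r * cis (INR (m + 2) * theta))%C.
Proof.
  intros Hf HF Hr.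
  assert (Hcs := sin2_cos2 theta); unfold Rsqr in Hcs.
  assert (Hrad : radius (r * cos theta, r * sin theta) = r).
  { unfold radius; simpl fst; simpl snd.
    replace ((r * cos theta) ^ 2 + (r * sin theta) ^ 2) with
      (r ^ 2 * (sin theta * sin theta + cos theta * cos theta)) by ring.
    rewrite Hcs, Rmult_1_r; apply sqrt_pow2; lra. }
  unfold DplusQ, Dplus, Dcov, ex_1, ex_2.
  rewrite !(Cpder_equivariant (m + 1) f F) by assumption.
  rewrite (HF r theta Hr).
  unfold AQ_1, AQ_2; rewrite Hrad; simpl fst; simpl snd.
  replace (INR (m + 2) * theta) with (INR (m + 1) * theta + theta).
  2:{ rewrite !plus_INR; simpl; ring. }
  unfold A_Q, cis; rewrite cos_plus, sin_plus, plus_INR; simpl (INR 1).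
  generalize (CDerive f r) (f r) (Atheta m r) (cos ((INR m + 1) * theta))
    (sin ((INR m + 1) * theta)) (cos theta) (sin theta) (INR m).
  intros [d1 d2] [f1 f2] A ck sk c s M.
  apply injective_projections; simpl; field; lra.
Qed.

(** * The static solution *)

Lemma continuous_of_derive (h dh : R -> R) s :
  (forall s, is_derive h s (dh s)) -> continuous h s.
Proof.
  intros H; apply (ex_derive_continuous (K := R_AbsRing) (V := R_NormedModule)).
  eexists; apply H.
Qed.

Lemma Q_den_pos m r : 0 < 1 + r ^ (2 * (m + 1)).
Proof.
  replace (2 * (m + 1))%nat with ((m + 1) * 2)%nat by lia.
  rewrite pow_mult; generalize (pow2_ge_0 (r ^ (m + 1))); lra.
Qed.

Lemma ex_derive_Q m r : ex_derive (Q m) r.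
Proof.
  assert (H := Q_den_pos m r); unfold Q.
  generalize dependent (2 * (m + 1))%nat; intros n H; auto_derive; lra.
Qed.

Lemma continuous_Q m r : continuous (Q m) r.
Proof.
  apply (ex_derive_continuous (K := R_AbsRing) (V := R_NormedModule)), ex_derive_Q.
Qed.

Lemma continuous_Q_density m r : continuous (fun s => Q m s ^ 2 * s) r.
Proof.
  apply (ex_derive_continuous (K := R_AbsRing) (V := R_NormedModule)).
  assert (H := ex_derive_Q m r); generalize dependent (Q m); intros q H.
  auto_derive; auto.
Qed.

(** The density [Q^2 s] integrates in closed form because, with [n = 2 (m + 1)], it
    is a multiple of the derivative [n s^(n-1) / (1 + s^n)^2] of
    [s^n / (1 + s^n)]. *)
Lemma is_RInt_Q_sqr m r :
  is_RInt (fun s => Q m s ^ 2 * s) 0 r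
    (4 * (INR m + 1) * (r ^ (2 * (m + 1)) / (1 + r ^ (2 * (m + 1))))).
Proof.
  pose (P := fun s =>
    4 * (INR m + 1) * (s ^ (2 * (m + 1)) / (1 + s ^ (2 * (m + 1))))).
  replace (4 * _ * _) with (minus (P r) (P 0)).
  2:{ unfold minus, plus, opp, P; simpl. rewrite pow_i by lia. field.
      generalize (Q_den_pos m r); simpl; lra. }
  apply (is_RInt_derive P).
  - intros s _; unfold P, Q; clear P; assert (H := Q_den_pos m s).
    assert (Hn : INR (2 * (m + 1)) = 2 * (INR m + 1)).
    { rewrite mult_INR, plus_INR; reflexivity. }
    assert (Hp : s ^ Init.Nat.pred (2 * (m + 1)) = s ^ m * s ^ m * s).
    { replace (Init.Nat.pred (2 * (m + 1))) with (m + m + 1)%nat by lia.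
      rewrite !pow_add; ring. }
    generalize dependent (2 * (m + 1))%nat; intros n H Hn Hp.
    auto_derive; [lra|].
    rewrite Hn, Hp, !Rpow_mult_distr, pow2_sqrt by lra.
    field; lra.
  - intros s _; apply continuous_Q_density.
Qed.

Lemma Atheta_eq m r :
  Atheta m r = - 2 * (INR m + 1) * (r ^ (2 * (m + 1)) / (1 + r ^ (2 * (m + 1)))).
Proof.
  unfold Atheta; rewrite (is_RInt_unique _ _ _ _ (is_RInt_Q_sqr m r)); lra.
Qed.

Lemma is_derive_Atheta m r : is_derive (Atheta m) r (- (1 / 2) * (Q m r ^ 2 * r)).
Proof.
  apply (is_derive_scal (fun x => RInt (fun s => Q m s ^ 2 * s) 0 x)).
  apply (is_derive_RInt (fun s => Q m s ^ 2 * s) _ 0).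
  - apply filter_forall; intros s.
    apply (RInt_correct (V := R_CompleteNormedModule)); eexists; apply is_RInt_Q_sqr.
  - apply continuous_Q_density.
Qed.

Lemma continuous_Atheta m r : continuous (Atheta m) r.
Proof. exact (continuous_of_derive _ _ r (is_derive_Atheta m)). Qed.

(** The Bogomolnyi equation for [Q], multiplied by [r] so that it holds up to and
    including the origin, where the integral defining [B_Q] starts. *)
Lemma is_derive_id_Q m r :
  is_derive (fun s => s * Q m s) r ((INR m + 1 + Atheta m r) * Q m r).
Proof.
  rewrite Atheta_eq; unfold Q; assert (H := Q_den_pos m r).
  assert (Hn : INR (2 * (m + 1)) = 2 * (INR m + 1)).
  { rewrite mult_INR, plus_INR; reflexivity. }
  assert (Hp : r ^ Init.Nat.pred (2 * (m + 1)) * r = r ^ (2 * (m + 1))).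
  { replace (2 * (m + 1))%nat with (S (Init.Nat.pred (2 * (m + 1)))) at 2 by lia.
    simpl; ring. }
  assert (Hm : INR m * r ^ Init.Nat.pred m * r = INR m * r ^ m).
  { destruct m; simpl; ring. }
  generalize dependent (2 * (m + 1))%nat; intros n H Hn Hp.
  auto_derive; [lra|].
  rewrite Hn.
  transitivity (sqrt 8 * (INR m + 1) *
    (r ^ m / (1 + r ^ n) + INR m * r ^ Init.Nat.pred m * r / (1 + r ^ n)
     - r ^ m * (2 * (INR m + 1) * (r ^ Init.Nat.pred n * r)) / (1 + r ^ n) ^ 2)).
  - field; lra.
  - rewrite Hm, Hp; field; lra.
Qed.

Lemma is_derive_Q m r : 0 < r ->
  is_derive (Q m) r ((INR m + Atheta m r) / r * Q m r).
Proof.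
  intros Hr.
  apply is_derive_ext_loc with (fun s => s * Q m s / s).
  - generalize (locally_pos r Hr); apply filter_imp; intros s Hs.
    change (s * Q m s / s = Q m s :> R); field; lra.
  - replace ((INR m + Atheta m r) / r * Q m r) with
      (((INR m + 1 + Atheta m r) * Q m r * r - r * Q m r * 1) / r ^ 2)
      by (field; lra).
    apply (is_derive_div (fun s => s * Q m s) (fun s => s));
      [apply is_derive_id_Q|apply (is_derive_id (K := R_AbsRing))|lra].
Qed.

Lemma Q_bound m r : 0 <= r -> 0 <= Q m r <= sqrt 8 * (INR m + 1).
Proof.
  intros Hr; unfold Q; assert (H := Q_den_pos m r).
  assert (Hc : 0 <= sqrt 8 * (INR m + 1)).
  { apply Rmult_le_pos; [apply sqrt_pos|generalize (pos_INR m); lra]. }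
  assert (Hm := pow_le r m Hr).
  assert (Hn := pow_le r (2 * (m + 1)) Hr).
  assert (Hle : r ^ m <= 1 + r ^ (2 * (m + 1))).
  { destruct (Rle_lt_dec r 1) as [H1|H1].
    - assert (r ^ m <= 1 ^ m) by (apply pow_incr; lra).
      rewrite pow1 in *; lra.
    - assert (r ^ m <= r ^ (2 * (m + 1))) by (apply Rle_pow; [lra|lia]).
      lra. }
  assert (Hq : 0 <= r ^ m / (1 + r ^ (2 * (m + 1))) <= 1).
  { split.
    - apply Rdiv_le_0_compat; lra.
    - apply Rle_div_l; lra. }
  split; [apply Rmult_le_pos; lra|].
  rewrite <- (Rmult_1_r (sqrt 8 * (INR m + 1))) at 2.
  apply Rmult_le_compat_l; lra.
Qed.

(** * Integrals up to infinity *)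

Section Tail.
Variables (g : R -> R) (M : R).
Hypothesis Hcont : forall s, continuous g s.
Hypothesis Hdecay : forall s, 0 < s -> Rabs (g s) <= M / s ^ 2.

Lemma ex_RInt_cont a b : ex_RInt g a b.
Proof. apply (ex_RInt_continuous (V := R_CompleteNormedModule)); auto. Qed.

Lemma RInt_tail_bound u v : 0 < u <= v -> Rabs (RInt g u v) <= M / u.
Proof.
  intros [Hu Huv].
  assert (HM : 0 <= M).
  { generalize (Hdecay 1 Rlt_0_1) (Rabs_pos (g 1)); lra. }
  apply Rle_trans with (M / u - M / v).
  2:{ assert (0 <= M / v) by (apply Rdiv_le_0_compat; lra); lra. }
  apply (norm_RInt_le g (fun s => M / s ^ 2) u v); auto.
  - intros s Hs; apply Hdecay; lra.
  - apply (RInt_correct (V := R_CompleteNormedModule)), ex_RInt_cont.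
  - replace (M / u - M / v) with (minus (- M / v) (- M / u)).
    2:{ unfold minus, plus, opp; simpl; field; lra. }
    apply (is_RInt_derive (fun s => - M / s)); intros s;
      rewrite Rmin_left, Rmax_right by lra; intros Hs.
    + auto_derive; [lra|field; lra].
    + apply (ex_derive_continuous (K := R_AbsRing) (V := R_NormedModule)).
      auto_derive; nra.
Qed.

Lemma ex_RInt_gen_tail a : ex_RInt_gen g (at_point a) (Rbar_locally p_infty).
Proof.
  assert (Hlim : exists l,
    filterlim (fun b => RInt g a b) (Rbar_locally p_infty) (locally l)).
  { apply (filterlim_locally_cauchy (U := R_CompleteSpace)); intros eps.
    assert (HM : 0 <= M).
    { generalize (Hdecay 1 Rlt_0_1) (Rabs_pos (g 1)); lra. }
    (* Beyond [N], the bound [M / u] on the tail is below [eps]; the [+ 1] keeps [N]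
       positive when [M] vanishes. *)
    set (N := (M + 1) / eps).
    assert (He := cond_pos eps).
    assert (HN : 0 < N) by (apply Rdiv_lt_0_compat; lra).
    assert (Hb : forall u v, N < u -> u <= v -> Rabs (RInt g u v) < eps).
    { intros u v Hu Huv; apply Rle_lt_trans with (M / u);
        [apply RInt_tail_bound; lra|].
      apply Rlt_div_l; [lra|].
      apply Rlt_le_trans with (eps * N); [|apply Rmult_le_compat_l; lra].
      unfold N.
      replace (eps * ((M + 1) / eps)) with (M + 1) by (field; lra); lra. }
    assert (Hd : forall u v, RInt g a v - RInt g a u = RInt g u v).
    { intros u v; rewrite <- (RInt_Chasles g a u v); try apply ex_RInt_cont.
      unfold plus; simpl; ring. }
    exists (fun b => N < b); split; [now exists N|].
    intros u v Hu Hv.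
    change (Rabs (RInt g a v - RInt g a u) < eps).
    destruct (Rle_lt_dec u v).
    - rewrite Hd; apply Hb; lra.
    - rewrite Rabs_minus_sym, Hd; apply Hb; lra. }
  destruct Hlim as [l Hl]; exists l; intros P HP.
  apply (Filter_prod _ _ _ (fun x => x = a) (fun b => P (RInt g a b))).
  - reflexivity.
  - exact (Hl P HP).
  - intros x b -> Hb; exists (RInt g a b); split; [|exact Hb].
    apply (RInt_correct (V := R_CompleteNormedModule)), ex_RInt_cont.
Qed.

Lemma is_derive_tail r :
  is_derive (fun s => RInt_gen g (at_point s) (Rbar_locally p_infty)) r (- g r).
Proof.
  apply is_derive_ext with
    (fun s => RInt g s 0 + RInt_gen g (at_point 0) (Rbar_locally p_infty)).
  - intros s; symmetry; apply is_RInt_gen_unique.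
    apply (is_RInt_gen_Chasles _ 0 (RInt g s 0)).
    + apply is_RInt_gen_at_point.
      apply (RInt_correct (V := R_CompleteNormedModule)), ex_RInt_cont.
    + apply RInt_gen_correct, ex_RInt_gen_tail.
  - rewrite <- (Rplus_0_r (- g r)).
    apply (is_derive_plus (K := R_AbsRing) (V := R_NormedModule));
      [|apply (is_derive_const (K := R_AbsRing) (V := R_NormedModule))].
    apply (is_derive_RInt' g (fun s => RInt g s 0) r 0).
    + apply filter_forall; intros s.
      apply (RInt_correct (V := R_CompleteNormedModule)), ex_RInt_cont.
    + apply Hcont.
Qed.
End Tail.

(** * The conjugation identity *)

Lemma CDerive_eq (f : R -> C) (g1 g2 : R -> R) (r d1 d2 : R) :
  0 < r -> (forall s, 0 < s -> f s = (g1 s, g2 s)) ->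
  is_derive g1 r d1 -> is_derive g2 r d2 -> CDerive f r = (d1, d2).
Proof.
  intros Hr Hf H1 H2; unfold CDerive; f_equal; apply is_derive_unique.
  - apply is_derive_ext_loc with g1; [|exact H1].
    generalize (locally_pos r Hr); apply filter_imp; intros s Hs.
    now rewrite (Hf s Hs).
  - apply is_derive_ext_loc with g2; [|exact H2].
    generalize (locally_pos r Hr); apply filter_imp; intros s Hs.
    now rewrite (Hf s Hs).
Qed.

(** The term [Q^2 / 2] is [- A_theta' / r]. *)
Lemma is_derive_potential_mult m (c : R) (h : R -> R) (r d : R) : 0 < r ->
  is_derive h r d ->
  is_derive (fun s => (c + Atheta m s) / s * h s) r
    ((c + Atheta m r) / r * d
     - ((c + Atheta m r) / r ^ 2 + Q m r ^ 2 / 2) * h r).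
Proof.
  intros Hr Hh; assert (HA := is_derive_Atheta m r).
  generalize dependent (Atheta m); intros A HA.
  auto_derive.
  - repeat split; try lra; eexists; eassumption.
  - rewrite (is_derive_unique (fun s : R => A s) _ _ HA),
      (is_derive_unique (fun s : R => h s) _ _ Hh); field; lra.
Qed.

(** The operators only see [f] on the half-line, whereas the integral in [B_Q] starts
    at the origin.  Working with an extension [h1 + i h2] of [f] that is twice
    differentiable on all of [R] makes its integrand continuous on the closed
    interval. *)
Section Radial.
Variables (m : nat) (h1 h2 dh1 dh2 ddh1 ddh2 : R -> R) (M : R) (f : R -> C).
Hypotheses (Dh1 : forall s, is_derive h1 s (dh1 s))
  (Dh2 : forall s, is_derive h2 s (dh2 s))
  (DDh1 : forall s, is_derive dh1 s (ddh1 s))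
  (DDh2 : forall s, is_derive dh2 s (ddh2 s))
  (Hdecay : forall s, 0 < s -> Rabs (h1 s) <= M / s ^ 2)
  (Hf : forall s, 0 < s -> f s = (h1 s, h2 s)).

Let T (s : R) :=
  RInt_gen (fun s => Q m s * h1 s) (at_point s) (Rbar_locally p_infty).

Lemma Q_h1_continuous s : continuous (fun s => Q m s * h1 s) s.
Proof.
  apply (continuous_mult (Q m) h1); [apply continuous_Q|].
  apply (continuous_of_derive h1 dh1); exact Dh1.
Qed.

Lemma Q_h1_decay s : 0 < s ->
  Rabs (Q m s * h1 s) <= sqrt 8 * (INR m + 1) * M / s ^ 2.
Proof.
  intros Hs; rewrite Rabs_mult.
  destruct (Q_bound m s) as [H0 H1]; [lra|].
  rewrite (Rabs_pos_eq _ H0).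
  unfold Rdiv; rewrite Rmult_assoc; apply Rmult_le_compat;
    [exact H0|apply Rabs_pos|exact H1|apply Hdecay, Hs].
Qed.

Lemma tail_eq s : 0 < s ->
  RInt_gen (fun s => Re (RtoC (Q m s) * f s)%C)
    (at_point s) (Rbar_locally p_infty) = T s.
Proof.
  intros Hs; unfold T; symmetry; apply RInt_gen_ext.
  - apply (Filter_prod _ _ _ (fun x => x = s) (fun b => s < b)).
    + reflexivity.
    + now exists s.
    + intros a b -> Hb; simpl; intros x; rewrite Rmin_left by lra; intros Hx.
      rewrite Hf by lra; simpl; ring.
  - exact (ex_RInt_gen_tail _ _ Q_h1_continuous Q_h1_decay s).
Qed.

Lemma L_Q_adj_eq s : 0 < s ->
  L_Q_adj m f s
  = (- dh1 s - (INR m + 1 + Atheta m s) / s * h1 s + Q m s * T s,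
     - dh2 s - (INR m + 1 + Atheta m s) / s * h2 s).
Proof.
  intros Hs; unfold L_Q_adj.
  rewrite (CDerive_eq f h1 h2 s _ _ Hs Hf (Dh1 s) (Dh2 s)), (tail_eq s Hs).
  rewrite (Hf s Hs); apply injective_projections; simpl; ring.
Qed.

(** Multiplication by [i] moves the nonlocal part of [L_Q_adj], which is real, out
    of sight of [B_Q]; by the Bogomolnyi equation the rest of the integrand is the
    derivative of [s Q h2], which vanishes at the origin. *)
Lemma B_Q_i_L_Q_adj r : 0 < r ->
  B_Q m (fun s => (Ci * L_Q_adj m f s)%C) r = Q m r * h2 r.
Proof.
  intros Hr; unfold B_Q.
  rewrite (RInt_ext _ (fun s => (INR m + 1 + Atheta m s) * Q m s * h2 s
                              + s * Q m s * dh2 s)).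
  2:{ intros s; rewrite Rmin_left by lra; intros Hs.
      rewrite L_Q_adj_eq by lra; simpl; field; lra. }
  assert (HI : is_RInt (fun s => (INR m + 1 + Atheta m s) * Q m s * h2 s
                              + s * Q m s * dh2 s) 0 r
     (minus (r * Q m r * h2 r) (0 * Q m 0 * h2 0))).
  { apply (is_RInt_derive (fun s => s * Q m s * h2 s)).
    - intros s _.
      apply (is_derive_mult (fun s => s * Q m s) h2);
        [apply is_derive_id_Q|apply Dh2|apply Rmult_comm].
    - intros s _.
      apply (continuous_plus (V := R_NormedModule)
        (fun s => (INR m + 1 + Atheta m s) * Q m s * h2 s)
        (fun s => s * Q m s * dh2 s)).
      + apply (continuous_mult (fun s => (INR m + 1 + Atheta m s) * Q m s) h2);
          [|apply (continuous_of_derive h2 dh2); exact Dh2].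
        apply (continuous_mult (fun s => INR m + 1 + Atheta m s) (Q m));
          [|apply continuous_Q].
        apply (continuous_plus (V := R_NormedModule) (fun _ => INR m + 1) (Atheta m));
          [apply continuous_const|].
        apply continuous_Atheta.
      + apply (continuous_mult (fun s => s * Q m s) dh2);
          [|apply (continuous_of_derive dh2 ddh2); exact DDh2].
        apply (continuous_mult (fun s => s) (Q m));
          [apply continuous_id|apply continuous_Q]. }
  rewrite (is_RInt_unique _ _ _ _ HI); unfold minus, plus, opp; simpl; field; lra.
Qed.

(** With the nonlocal terms reduced to [- i Q^2 f], both sides are second-order
    differential expressions in [h1] and [h2] with the same coefficients. *)
Lemma L_Q_i_L_Q_adj r : 0 < r ->
  L_Q m (fun s => (Ci * L_Q_adj m f s)%C) r = (Ci * A_Q_adj m (A_Q m f) r)%C.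
Proof.
  intros Hr.
  assert (HQ := is_derive_Q m r Hr).
  assert (HT : is_derive T r (- (Q m r * h1 r))) by
    exact (is_derive_tail _ _ Q_h1_continuous Q_h1_decay r).
  assert (HQT := is_derive_mult (Q m) T r _ _ HQ HT Rmult_comm).
  assert (V1 := is_derive_potential_mult m (INR m + 1) h1 r _ Hr (Dh1 r)).
  assert (V2 := is_derive_potential_mult m (INR m + 1) h2 r _ Hr (Dh2 r)).
  assert (HL := CDerive_eq (fun s => (Ci * L_Q_adj m f s)%C)
    (fun s => dh2 s + (INR m + 1 + Atheta m s) / s * h2 s)
    (fun s => (Q m s * T s - (INR m + 1 + Atheta m s) / s * h1 s) - dh1 s) r _ _ Hr
    ltac:(intros s Hs; cbv beta; rewrite (L_Q_adj_eq s Hs);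
          apply injective_projections;
          simpl; ring)
    (is_derive_plus (K := R_AbsRing) (V := R_NormedModule) _ _ _ _ _ (DDh2 r) V2)
    (is_derive_minus (K := R_AbsRing) (V := R_NormedModule) _ _ _ _ _
      (is_derive_minus (K := R_AbsRing) (V := R_NormedModule) _ _ _ _ _ HQT V1)
      (DDh1 r))).
  assert (HA : forall s, 0 < s -> A_Q m f s =
     (dh1 s - (INR m + 1 + Atheta m s) / s * h1 s,
      dh2 s - (INR m + 1 + Atheta m s) / s * h2 s)).
  { intros s Hs; unfold A_Q.
    rewrite (CDerive_eq f h1 h2 s _ _ Hs Hf (Dh1 s) (Dh2 s)), (Hf s Hs).
    apply injective_projections; simpl; ring. }
  assert (HR := CDerive_eq (A_Q m f) _ _ r _ _ Hr HA
    (is_derive_minus (K := R_AbsRing) (V := R_NormedModule) _ _ _ _ _ (DDh1 r) V1)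
    (is_derive_minus (K := R_AbsRing) (V := R_NormedModule) _ _ _ _ _ (DDh2 r) V2)).
  unfold L_Q, A_Q_adj.
  rewrite B_Q_i_L_Q_adj, HL, HR, (HA r Hr), (L_Q_adj_eq r Hr) by exact Hr.
  apply injective_projections; unfold minus, plus, opp, mult; simpl;
    unfold plus, opp, mult; simpl; field; lra.
Qed.
End Radial.

(** The restriction of [F] to the first coordinate axis is a smooth extension of
    [f] across the origin. *)
Lemma Schwartz_conjugation (m : nat) (f : R -> C) (F : plane -> C) (r : R) :
  schwartz F -> equivariant (m + 1) f F -> 0 < r ->
  L_Q m (fun s => (Ci * L_Q_adj m f s)%C) r = (Ci * A_Q_adj m (A_Q m f) r)%C.
Proof.
  intros [Hsmooth Hdecay] HF Hr.
  destruct (Hsmooth 2%nat) as [H1 H2].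
  destruct (Hdecay 2%nat 0%nat 0%nat) as [M HM]; simpl in HM.
  pose (restr := fun (u : plane -> R) (s : R) =>
    u (plus ((0, 0) : plane) (scal s ex_1))).
  assert (Hpt : forall s : R, plus ((0, 0) : plane) (scal s ex_1) = (s, 0) :> plane).
  { intros s; change ((0 + s * 1, 0 + s * 0) = (s, 0) :> R * R).
    f_equal; ring. }
  assert (HD : forall k u s, class_C (S k) u ->
     is_derive (restr u) s (restr (pder ex_1 u) s)).
  { intros k u s Hu; apply (is_derive_line k u ex_1 (0, 0) s Hu). }
  assert (Hray : forall s, 0 < s -> f s = F (s, 0)).
  { intros s Hs; assert (E := HF s 0 Hs); unfold cis in E.
    rewrite Rmult_0_r, cos_0, sin_0, Rmult_1_r, Rmult_0_r in E; rewrite E.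
    apply injective_projections; simpl; ring. }
  apply (L_Q_i_L_Q_adj m (restr (fun p => Re (F p))) (restr (fun p => Im (F p)))
    (restr (pder ex_1 (fun p => Re (F p)))) (restr (pder ex_1 (fun p => Im (F p))))
    (restr (pder ex_1 (pder ex_1 (fun p => Re (F p)))))
    (restr (pder ex_1 (pder ex_1 (fun p => Im (F p))))) M); try exact Hr.
  - intros s; apply (HD 1%nat), H1.
  - intros s; apply (HD 1%nat), H2.
  - intros s; apply (HD 0%nat), class_C_pder, H1.
  - intros s; apply (HD 0%nat), class_C_pder, H2.
  - intros s Hs; unfold restr; rewrite Hpt.
    assert (E := HM (s, 0)).
    unfold radius in E; simpl in E.
    replace (s * (s * 1) + 0 * (0 * 1)) with (s ^ 2) in E by ring.
    rewrite sqrt_pow2 in E by lra.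
    apply Rle_trans with (Cmod (F (s, 0))); [apply re_le_Cmod|].
    apply Rle_div_r; [nra|]. simpl; lra.
  - intros s Hs; unfold restr; rewrite Hpt, (Hray s Hs).
    apply surjective_pairing.
Qed.

Theorem proposition2p2 :
  (forall (phi : spacetime -> C) (A0 A1 A2 : spacetime -> R),
     Cclass_C 3 phi -> class_C 2 A0 -> class_C 2 A1 -> class_C 2 A2 ->
     CSS_solution phi A0 A1 A2 ->
     forall p : spacetime,
       (Ci * Dcov e_t A0 (Dplus e_1 e_2 A1 A2 phi) p
        + RtoC (1 / 2 * Cmod (phi p) ^ 2) * Dplus e_1 e_2 A1 A2 phi p
        - Dplus_adj e_1 e_2 A1 A2
            (Dplus e_1 e_2 A1 A2 (Dplus e_1 e_2 A1 A2 phi)) p)%C = RtoC 0)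
  /\
  (forall m : nat,
     (forall (f : R -> C) (F : plane -> C),
        schwartz F -> equivariant (m + 1) f F ->
        forall r : R, 0 < r ->
          L_Q m (fun s => (Ci * L_Q_adj m f s)%C) r
          = (Ci * A_Q_adj m (A_Q m f) r)%C)
     /\
     (forall (f : R -> C) (F : plane -> C),
        (forall r : R, 0 < r -> Cex_derive f r) -> equivariant (m + 1) f F ->
        forall r theta : R, 0 < r ->
          DplusQ m F (r * cos theta, r * sin theta)
          = (A_Q m f r * cis (INR (m + 2) * theta))%C)).
Proof.
  split.
  - intros phi A0 A1 A2 Hphi HA0 HA1 HA2 Hsol p; apply CSS_Dplus; assumption.
  - intros m; split.
    + intros f F HF Heq r Hr; apply Schwartz_conjugation with F; assumption.
    + intros f F Hf Heq r theta Hr; apply DplusQ_equivariant; auto.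
Qed.
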